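(* Let $D$ be a connected mixed graph and $\alpha\in\mathbb{C}$ with $|\alpha|=1$. The following are equivalent: (i) $s^\alpha(u)=1$ for at least one $u\in V(D)$; (ii) $s^\alpha(u)=1$ for every $u\in V(D)$; (iii) $h_\alpha(W')=h_\alpha(W'')$ for every pair $W',W''$ of mixed walks having the same start vertex and the same end vertex; (iv) $D$ is an $\alpha$-monograph of first kind.
   Context: A mixed graph $D$ is obtained from a finite simple undirected graph $\Gamma(D)$ by replacing some edges by arcs: between any two adjacent vertices $u,v$ there is exactly one of a digon $u\sim v$, an arc $u\to v$, or an arc $v\to u$; connectedness and cycles refer to $\Gamma(D)$. For $|\alpha|=1$ set $h_{uv}=1$ if $u\sim v$, $\alpha$ if $u\to v$, $\bar\alpha$ if $v\to u$. A mixed walk $W=v_1,\dots,v_k$ (consecutive vertices adjacent) has value $h_\alpha(W)=h_{v_1v_2}\cdots h_{v_{k-1}v_k}$ (equal to $1$ if $k=1$). The $\alpha$-store of $u$ is $S^\alpha(u)=\{h_\alpha(W): W$ a closed mixed walk starting and ending at $u\}$ and $s^\alpha(u)=|S^\alpha(u)|$. For a cycle $C$ with vertices $v_1,\dots,v_\ell$ in cyclic order, a traversal $\vec C$ is the closed walk $v_1,\dots,v_\ell,v_1$ (either direction, any start). $D$ is an $\alpha$-monograph of first kind if $h_\alpha(\vec C)=1$ for every cycle $C$ and every traversal $\vec C$. *)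

(* Defs.v *)
From HB Require Import structures.
From mathcomp Require Import all_boot all_order all_algebra.
From mathcomp Require Import complex.
From mathcomp Require Import mathcomp_extra boolp classical_sets functions cardinality reals.

Set Implicit Arguments.
Unset Strict Implicit.
Unset Printing Implicit Defensive.

Import Order.TTheory GRing.Theory Num.Theory.

Local Open Scope ring_scope.
Local Open Scope classical_set_scope.
Local Open Scope card_scope.

(* [edge] is the adjacency of the underlying simple graph; an edge that carries
   no arc in either direction is a digon. *)
Record mixedGraph := MixedGraph {
  vertex :> finType;
  edge : rel vertex;
  arc : rel vertex;
  edge_sym : symmetric edge;
  edge_irrefl : irreflexive edge;
  arc_edge : subrel arc edge;
  arc_asym : forall u v, arc u v -> ~~ arc v u
}.

Definition digon (D : mixedGraph) : rel D :=
  [rel u v | [&& edge u v, ~~ arc u v & ~~ arc v u]].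

(* As usual, a connected graph has at least one vertex. *)
Definition connected_graph (D : mixedGraph) : Prop :=
  (0 < #|D|)%N /\ forall u v : D, connect (@edge D) u v.

(* The value 0 on non-adjacent pairs is a dummy: [h_step] is only used along
   walks. *)
Definition h_step (R : realType) (D : mixedGraph) (alpha : R[i]) (u v : D) :
    R[i] :=
  if digon u v then 1
  else if arc u v then alpha
  else if arc v u then alpha^*
  else 0.

(* The sequence W is a mixed walk that starts at u and ends at v; in particular
   W is nonempty. *)
Definition walk_from_to (D : mixedGraph) (u v : D) (W : seq D) : bool :=
  if W is x :: p then [&& x == u, path (@edge D) x p & last x p == v]
  else false.

Definition h_walk (R : realType) (D : mixedGraph) (alpha : R[i]) (W : seq D) :
    R[i] :=
  \prod_(e <- zip W (behead W)) h_step alpha e.1 e.2.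

Definition store (R : realType) (D : mixedGraph) (alpha : R[i]) (u : D) :
    set R[i] :=
  [set h_walk alpha W | W in [set W | walk_from_to u u W]].

(* The store may be infinite, so its cardinality is a relation to n. *)
Definition store_card (R : realType) (D : mixedGraph) (alpha : R[i]) (u : D)
    (n : nat) : Prop :=
  store alpha u #= `I_n.

(* The list of the vertices of a cycle of the underlying graph, in cyclic
   order. *)
Definition graph_cycle (D : mixedGraph) (C : seq D) : bool :=
  [&& (2 < size C)%N, cycle (@edge D) C & uniq C].

Definition close_walk (T : Type) (s : seq T) : seq T :=
  if s is x :: _ then rcons s x else [::].

Definition traversal (D : mixedGraph) (C W : seq D) : Prop :=
  exists k, W = close_walk (rot k C) \/ W = close_walk (rot k (rev C)).

Definition monograph_first_kind (R : realType) (D : mixedGraph)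
    (alpha : R[i]) : Prop :=
  forall C W : seq D, graph_cycle C -> traversal C W -> h_walk alpha W = 1.

(* Main.v *)
(* Reversing a walk inverts its value, so all closed walks at a vertex have
   value 1 as soon as this holds at some other vertex: conjugate by a walk
   joining the two. For a monograph of first kind, a closed walk of minimal
   length with value different from 1 would have to be a cycle, since at a
   repeated vertex it splits into two shorter closed walks, and a closed walk
   of length two has value 1. *)
Require Import Defs.
From mathcomp Require Import all_boot all_order all_algebra.
From mathcomp Require Import complex.
From mathcomp Require Import zify.
From mathcomp Require Import mathcomp_extra boolp classical_sets functions cardinality reals.

Set Implicit Arguments.
Unset Strict Implicit.
Unset Printing Implicit Defensive.

Import Order.TTheory GRing.Theory Num.Theory.

Local Open Scope ring_scope.
Local Open Scope classical_set_scope.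

Lemma not_uniq_split (T : eqType) (s : seq T) :
  ~~ uniq s -> exists y s1 s2 s3, s = s1 ++ y :: s2 ++ y :: s3.
Proof.
elim: s => //= x s IHs; rewrite negb_and negbK => /orP[].
  by case/splitPr => s2 s3; exists x, [::], s2, s3.
by move=> /IHs[y [s1 [s2 [s3 ->]]]]; exists y, (x :: s1), s2, s3.
Qed.

(** A digon contributes 1 both ways; an arc contributes [alpha] one way and its conjugate the other,
    with product the squared modulus of [alpha]. *)
Lemma h_step_inv (R : realType) (D : mixedGraph) (alpha : R[i]) (u v : D) :
  `|alpha| = 1 -> edge u v -> h_step alpha u v * h_step alpha v u = 1.
Proof.
move=> a1 uv; have aa : alpha * alpha^* = 1 by rewrite -normCK a1 expr1n.
rewrite /h_step /digon /= uv edge_sym uv /=.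
case: (boolP (Defs.arc u v)) => [auv | _]; case: (boolP (Defs.arc v u)) => [avu | _] /=.
- by have := arc_asym auv; rewrite avu.
- by [].
- by rewrite mulrC.
- by rewrite mulr1.
Qed.

Lemma h_walk1 (R : realType) (D : mixedGraph) (alpha : R[i]) (x : D) :
  h_walk alpha [:: x] = 1.
Proof. exact: big_nil. Qed.

Lemma h_walk_cons (R : realType) (D : mixedGraph) (alpha : R[i]) (x y : D) p :
  h_walk alpha [:: x, y & p] = h_step alpha x y * h_walk alpha (y :: p).
Proof. exact: big_cons. Qed.

Lemma h_walk_cat (R : realType) (D : mixedGraph) (alpha : R[i]) (x : D) p q :
  h_walk alpha (x :: p ++ q) =
  h_walk alpha (x :: p) * h_walk alpha (last x p :: q).
Proof.
elim: p x => [|y p IHp] x /=; first by rewrite h_walk1 mul1r.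
by rewrite !h_walk_cons IHp mulrA.
Qed.

Lemma walk_cat (D : mixedGraph) (u v w : D) p q :
  walk_from_to u v (u :: p) -> walk_from_to v w (v :: q) ->
  walk_from_to u w (u :: p ++ q).
Proof.
rewrite /= !eqxx cat_path last_cat /= => /andP[-> /eqP->] /andP[-> ->].
by [].
Qed.

(** The witness is built edge by edge as the reversed walk; only its endpoints and value matter
    later, so it stays existential. *)
Lemma reverse_walk (R : realType) (D : mixedGraph) (alpha : R[i]) (u v : D) p :
  `|alpha| = 1 -> walk_from_to u v (u :: p) ->
  exists2 q, walk_from_to v u (v :: q) &
    h_walk alpha (u :: p) * h_walk alpha (v :: q) = 1.
Proof.
move=> a1; elim: p u => [|y p IHp] u.
  by case/and3P => _ _ /eqP <-; exists [::]; rewrite /= ?eqxx // !h_walk1 mul1r.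
case/and3P => _ /andP[uy yp] lp.
have [|q vq hq] := IHp y; first by apply/and3P; split.
have yu : walk_from_to y u [:: y; u] by rewrite /= !eqxx edge_sym uy.
exists (q ++ [:: u]); first exact: walk_cat vq yu.
rewrite h_walk_cons h_walk_cat; case/and3P: vq => _ _ /eqP->.
rewrite h_walk_cons h_walk1 mulr1 mulrA -(mulrA (h_step _ _ _)) hq mulr1.
exact: h_step_inv.
Qed.

Definition trivial_at (R : realType) (D : mixedGraph) (alpha : R[i]) (u : D) :=
  forall p, walk_from_to u u (u :: p) -> h_walk alpha (u :: p) = 1.

(** The one-vertex walk always puts 1 into the store, so a one-element store can only be the
    singleton of 1. *)
Lemma store_card1P (R : realType) (D : mixedGraph) (alpha : R[i]) (u : D) :
  store_card alpha u 1 <-> trivial_at alpha u.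
Proof.
have S1 : store alpha u 1.
  by exists [:: u]; [rewrite /= !eqxx | rewrite h_walk1].
split=> [/card_set_bijP[f [f1 f_inj _]] p up | triv].
  have Sp : store alpha u (h_walk alpha (u :: p)) by exists (u :: p).
  apply: f_inj; rewrite ?inE //.
  by move: (f1 _ Sp) (f1 _ S1); rewrite /= !ltnS !leqn0 => /eqP-> /eqP->.
rewrite /store_card; suff -> : store alpha u = [set 1] by apply: card_set1.
apply/seteqP; split=> [_ [W uW <-] | _ -> //] /=.
case: W uW => //= x p /[dup] /and3P[/eqP-> _ _]; apply: triv.
Qed.

Lemma trivial_at_walk (R : realType) (D : mixedGraph) (alpha : R[i])
    (u v : D) q :
  `|alpha| = 1 -> walk_from_to u v (u :: q) ->
  trivial_at alpha u -> trivial_at alpha v.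
Proof.
move=> a1 uq triv p vp; have [r vr hqr] := reverse_walk a1 uq.
have := triv _ (walk_cat (walk_cat uq vp) vr).
case/and3P: uq => _ _ /eqP lq; case/and3P: vp => _ _ /eqP lp.
by rewrite !h_walk_cat last_cat lq lp mulrAC hqr mul1r.
Qed.

Lemma monograph_trivial_at (R : realType) (D : mixedGraph) (alpha : R[i])
    (u : D) :
  `|alpha| = 1 -> monograph_first_kind D alpha -> trivial_at alpha u.
Proof.
move=> a1 mono p; have [n] := ubnP (size p).
elim: n u p => // n IHn u p; rewrite ltnS => le_p_n.
(* Only [p] is tested for repetitions: a nonempty [p] ends at [u], so [u :: p] always repeats
   [u]. *)
have [|/not_uniq_split[y [p1 [p2 [p3 def_p]]]]] := boolP (uniq p).
  case/lastP: p le_p_n => [|p x] _; first by rewrite h_walk1.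
  rewrite rcons_uniq /= last_rcons eqxx /= => Up /andP[up /eqP def_x].
  rewrite {x}def_x in Up up *.
  have [gt1p | le1p] := ltnP 1 (size p).
    apply: (mono (u :: p)); last by exists 0%N; left; rewrite rot0.
    by rewrite /graph_cycle /= ltnS gt1p up.
  (* Too short for a cycle: the walk is either a loop at [u], which is excluded, or one edge
     traversed back and forth. *)
  case: p le1p up {Up} => [|y [|//]] _ /=; first by rewrite edge_irrefl.
  by case/andP=> uy _; rewrite !h_walk_cons h_walk1 mulr1 h_step_inv.
rewrite {}def_p in le_p_n * => /and3P[_].
rewrite -cat_rcons -[p2 ++ _]cat_rcons catA !cat_path !last_cat !last_rcons.
move=> /andP[/andP[p1P p2P] p3P] lp3.
(* The inner closed walk at [y] has value 1 by induction; excising it leaves a shorter closed walk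
   at [u]. *)
rewrite -catA !h_walk_cat !last_rcons (IHn y (rcons p2 y)).
- rewrite mul1r; have := IHn u (rcons p1 y ++ p3).
  rewrite h_walk_cat last_rcons; apply.
    by move: le_p_n; rewrite !(size_cat, size_rcons) /= size_cat /=; lia.
  by rewrite /= eqxx cat_path p1P last_cat last_rcons p3P.
- by move: le_p_n; rewrite size_rcons size_cat /= size_cat /=; lia.
- by rewrite /= eqxx p2P last_rcons eqxx.
Qed.

Lemma trivial_at_monograph (R : realType) (D : mixedGraph) (alpha : R[i]) :
  (forall u : D, trivial_at alpha u) -> monograph_first_kind D alpha.
Proof.
move=> triv C W /and3P[_ cycC _] travW.
(* Distinctness of the vertices is irrelevant here, so one claim covers all rotations and
   reversals. *)
have close C' : cycle (@edge D) C' -> h_walk alpha (close_walk C') = 1.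
  case: C' => [_|x p /= xp]; first exact: big_nil.
  by apply: triv; rewrite /= eqxx xp last_rcons eqxx.
case: travW => k [] ->; apply: close; rewrite rot_cycle // rev_cycle.
by rewrite (eq_cycle (e' := @edge D)) // => x y; rewrite edge_sym.
Qed.

Theorem theorem5p7 (R : realType) (D : mixedGraph) (alpha : R[i]) :
  connected_graph D -> `|alpha| = 1 ->
  [<-> exists u : D, store_card alpha u 1;
       forall u : D, store_card alpha u 1;
       forall (u v : D) (W' W'' : seq D),
         walk_from_to u v W' -> walk_from_to u v W'' ->
         h_walk alpha W' = h_walk alpha W'';
       monograph_first_kind D alpha].
Proof.
move=> [/card_gt0P[u0 _] conn] a1; tfae.
- move=> [u /store_card1P triv] v; apply/store_card1P.
  have /connectP[q uq lq] := conn u v.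
  apply: (trivial_at_walk (q := q)) a1 _ triv.
  by rewrite /walk_from_to eqxx uq lq eqxx.
- move=> triv u v [//|x p] [//|y q] up uq.
  have /and3P[/eqP def_x _ /eqP lp] := up; have /and3P[/eqP def_y _ /eqP lq] := uq.
  rewrite {x}def_x {y}def_y in up uq lp lq *.
  have [r vr hqr] := reverse_walk a1 uq.
  have /store_card1P/(_ _ (walk_cat up vr)) := triv u.
  rewrite h_walk_cat lp => hpr.
  (* The walks along [p] and [q] have the same inverse value, that of the walk along [r]. *)
  by rewrite -[LHS]mulr1 -hqr mulrCA hpr mulr1.
(* A closed walk is compared with the one-vertex walk at its base point. *)
- move=> eqW; apply: trivial_at_monograph => u p up.
  by rewrite (eqW u u _ [:: u] up) ?h_walk1 //= !eqxx.
- by move=> mono; exists u0; apply/store_card1P/monograph_trivial_at.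
Qed.
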